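(* Let $s$ be a positive integer and let $G$ be a connected graph on $n$ vertices with $n\ge 2s$ and $D(G;s)=n-2s+1$. Then $W(G)\le W(P_n)$, and equality holds if and only if $G\cong P_n$.
   Context: All graphs are finite, simple and undirected. For a connected graph $G$, $d(u,v)$ denotes the length of a shortest $u$–$v$ path. The Wiener index is $W(G)=\sum_{\{u,v\}\subseteq V(G)} d(u,v)$, the sum over all unordered pairs of distinct vertices. For nonempty $V_1,V_2\subseteq V(G)$, $d(V_1,V_2)=\min\{d(x,y): x\in V_1, y\in V_2\}$. For a positive integer $s$, the conditional diameter is $D(G;s)=\max\{d(V_1,V_2): V_1,V_2\subseteq V(G),\ |V_1|=|V_2|=s\}$. $P_n$ denotes the path on $n$ vertices. *)

(* Defs.v *)
From mathcomp Require Import all_boot.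

Set Implicit Arguments.
Unset Strict Implicit.
Unset Printing Implicit Defensive.

(* A simple graph on a finite vertex type T is a symmetric irreflexive
   adjacency relation e : rel T. *)
Section Graph.

Variables (T : finType) (e : rel T).

Definition connected_graph : Prop := forall x y : T, connect e x y.

Definition has_path_of_length (x y : T) (k : nat) : bool :=
  [exists p : k.-tuple T, [&& path e x p, uniq (x :: p) & last x p == y]].

(* A path has at most #|T| - 1 edges, so the search through 0, ..., #|T| - 1
   is exhaustive; the value is #|T| when there is no x-y path. *)
Definition dist (x y : T) : nat :=
  find (has_path_of_length x y) (iota 0 #|T|).

(* Comparing ranks in the enumeration of T selects exactly one ordering of
   each unordered pair of distinct vertices. *)
Definition wiener_index : nat :=
  \sum_(x : T) \sum_(y : T | enum_rank x < enum_rank y) dist x y.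

(* Since dist is bounded by #|T|, the default value #|T| only matters when
   A or B is empty. *)
Definition set_dist (A B : {set T}) : nat :=
  \big[minn/#|T|]_(x in A) \big[minn/#|T|]_(y in B) dist x y.

Definition cond_diam (s : nat) : nat :=
  \max_(A : {set T} | #|A| == s) \max_(B : {set T} | #|B| == s) set_dist A B.

End Graph.

Definition path_graph (n : nat) : rel 'I_n :=
  fun i j => (i.+1 == j :> nat) || (j.+1 == i :> nat).

Definition graph_iso (T U : finType) (e : rel T) (f : rel U) : Prop :=
  exists2 h : T -> U, bijective h & forall x y, f (h x) (h y) = e x y.

(* Main.v *)
Require Import Defs.
From mathcomp Require Import all_boot.
From mathcomp Require Import zify.

(** The bound holds for every connected graph.  Add the vertices one at a time,
each adjacent to an earlier one.  A function changing by at most 1 along edges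
takes an interval of values on each initial segment; hence the distances from
the newest of k vertices to all of them sum to at most 0 + 1 + ... + (k - 1),
and the sum of these bounds over k is W(P_n).  Equality forces some vertex to be
at distance n - 1 from the last vertex v, so that the distance from v is
a bijection onto {0, ..., n - 1}, and this is an isomorphism with P_n. *)

Set Implicit Arguments.
Unset Strict Implicit.
Unset Printing Implicit Defensive.

(** * Distances realised by shortest paths *)

Section Distance.

Variables (T : finType) (e : rel T).
Hypothesis e_conn : connected_graph e.

(** Deleting loops gives a duplicate-free path that is no longer and has fewer than [#|T|] edges, so
    its length lies in the range searched by [dist]. *)
Lemma dist_le_path x p : path e x p -> dist e x (last x p) <= size p.
Proof.
move=> ep; case: (shortenP ep) => q eq uq sub_qp.
have size_q : size q <= size p by apply: uniq_leq_size => //; case/andP: uq.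
apply: leq_trans size_q.
have lt_q : size q < #|T| by have := max_card (mem (x :: q)); rewrite (card_uniqP uq).
rewrite /dist leqNgt; apply/negP => /(before_find 0).
rewrite nth_iota // add0n => /negbT/negP; apply.
by apply/existsP; exists (in_tuple q); rewrite eq uq /=.
Qed.

Lemma dist_path x y :
  exists p, [/\ path e x p, last x p = y & size p = dist e x y].
Proof.
have [p ep def_y] := connectP (e_conn x y).
have has_dist : has (has_path_of_length e x y) (iota 0 #|T|).
  rewrite def_y; case: (shortenP ep) => q eq uq _.
  have lt_q : size q < #|T|
    by have := max_card (mem (x :: q)); rewrite (card_uniqP uq).
  apply/hasP; exists (size q); first by rewrite mem_iota.
  by apply/existsP; exists (in_tuple q); rewrite eq uq /=.
have := nth_find 0 has_dist; rewrite nth_iota; last first.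
  by rewrite has_find size_iota in has_dist.
rewrite add0n => /existsP[q /and3P[eq _ /eqP last_q]].
by exists q; rewrite size_tuple.
Qed.

Lemma dist_refl x : dist e x x = 0.
Proof. by apply/eqP; rewrite -leqn0; apply: (@dist_le_path x [::]). Qed.

Lemma dist_edge_le x y z : e y z -> dist e x z <= (dist e x y).+1.
Proof.
move=> eyz; have [p [ep last_p <-]] := dist_path x y.
have := @dist_le_path x (rcons p z); rewrite last_rcons size_rcons; apply.
by rewrite rcons_path ep last_p.
Qed.

(** [z] is the last vertex before [y] on a shortest path. *)
Lemma dist_pred x y k :
  dist e x y = k.+1 -> exists2 z, e z y & dist e x z = k.
Proof.
move=> d_xy; have [p [ep last_p]] := dist_path x y.
case/lastP: p => [|p z] in ep last_p *; rewrite d_xy ?size_rcons //.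
rewrite last_rcons in last_p; move: ep; rewrite last_p rcons_path.
case/andP=> ep ez [sz_p]; exists (last x p) => //.
by have := dist_le_path ep; have := @dist_edge_le x _ _ ez; lia.
Qed.

Lemma lipschitz_dist (g : T -> nat) :
  (forall x y, e x y -> g y <= (g x).+1) ->
  forall x y, g y <= g x + dist e x y.
Proof.
move=> g_edge x y; have [p [ep <- <-]] := dist_path x y.
elim: p x ep => [|z p IHp] x /=; first by rewrite addn0.
by case/andP=> /g_edge le_gz /IHp; lia.
Qed.

Lemma dist_sym : symmetric e -> forall x y, dist e x y = dist e y x.
Proof.
move=> e_sym x y; apply/eqP; rewrite eqn_leq.
have le_dist a b : dist e a b <= dist e b a.
  (* The distance to [b] vanishes at [b] and changes by at most 1 along edges, so at [a] it is at
     most [dist e b a]. *)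
  have := @lipschitz_dist (dist e ^~ b) _ b a; rewrite dist_refl add0n; apply.
  move=> u v; rewrite e_sym => evu.
  have [p [ep <- <-]] := dist_path u b.
  by apply: (@dist_le_path v (u :: p)); rewrite /= evu.
by rewrite !le_dist.
Qed.

(** Sums over ordered pairs no longer depend on the enumeration of [T]; symmetry accounts for the
    factor 2, and the diagonal contributes 0. *)
Lemma double_wiener_index : symmetric e ->
  (wiener_index e).*2 = \sum_x \sum_y dist e x y.
Proof.
move=> e_sym; rewrite -addnn /wiener_index.
have swap : \sum_x \sum_(y : T | enum_rank x < enum_rank y) dist e x y =
    \sum_x \sum_(y : T | enum_rank y < enum_rank x) dist e x y.
  rewrite (exchange_big_dep predT) //=; apply: eq_bigr => y _.
  by apply: eq_bigr => x _; rewrite dist_sym.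
rewrite {2}swap -big_split; apply: eq_bigr => x _ /=.
rewrite [RHS](bigID (fun y => enum_rank x < enum_rank y)) /=; congr (_ + _).
rewrite [RHS](bigD1 x) ?ltnn //= dist_refl add0n; apply: eq_bigl => y.
rewrite -leqNgt ltn_neqAle andbC; congr (_ && ~~ _).
by rewrite -(inj_eq enum_rank_inj).
Qed.

End Distance.

(** Induction by removing an element with the largest value, which is at most [#|S|.-1]. Equality of
    the sums forces that value to be exactly [#|S|.-1]. *)
Lemma sum_gap_free_le (T : finType) (f : T -> nat) (S : {set T}) :
    (forall y k, y \in S -> k < f y -> exists2 z, z \in S & f z = k) ->
  \sum_(y in S) f y <= \sum_(i < #|S|) i
  /\ (S != set0 -> \sum_(y in S) f y = \sum_(i < #|S|) i ->
      exists2 y, y \in S & f y = #|S|.-1).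
Proof.
move: {2}#|S| (erefl #|S|) => m; elim: m S => [|m IHm] S card_S gap_free.
  by move/eqP: card_S; rewrite cards_eq0 => /eqP->; rewrite big_set0 eqxx.
have [x Sx] : exists x, x \in S by apply/card_gt0P; rewrite card_S.
case: (@arg_maxnP _ x (mem S) f Sx) => y; rewrite -[mem S y]/(y \in S) => Sy max_y.
have card_Sy : #|S :\ y| = m by move: card_S; rewrite (cardsD1 y) Sy => -[].
have le_fy : f y <= m.
  (* Each of the [f y] values below [f y] is attained on [S :\ y], which has [m] elements. *)
  rewrite -card_Sy cardE -(size_map f) -(size_iota 0 (f y)).
  apply: uniq_leq_size (iota_uniq _ _) _ => k; rewrite mem_iota add0n => lt_k.
  have [z Sz fz] := gap_free _ _ Sy lt_k; rewrite -fz; apply: map_f.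
  by rewrite mem_enum !inE Sz andbT; apply: contraTneq lt_k => <-; rewrite fz ltnn.
have [|le_sum _] := IHm _ card_Sy.
  (* Removing [y] opens no gap: a value below [f u] is also below the maximum [f y], so its witness
     is not [y]. *)
  move=> u k /setD1P[_ Su] lt_k; have [z Sz fz] := gap_free _ _ Su lt_k.
  exists z => //; rewrite !inE Sz andbT; apply: contraTneq lt_k => zy.
  by rewrite -fz zy -leqNgt; apply: max_y.
rewrite card_Sy in le_sum.
rewrite card_S big_ord_recr (big_setD1 y) //=.
split=> [|_ eq_sum]; first by rewrite addnC leq_add.
exists y => //; apply/eqP; rewrite eqn_leq le_fy /=.
by rewrite -(leq_add2l (\sum_(i < m) i)) -eq_sum addnC leq_add2r.
Qed.

(** * The upper bound, adding one vertex at a time *)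

Section UpperBound.

Variables (T : finType) (e : rel T).
Hypotheses (e_sym : symmetric e) (e_conn : connected_graph e).

Let lipschitz (f : T -> nat) := forall x y, e x y -> f y <= (f x).+1.

Lemma lipschitz_gap_free_insert (S : {set T}) u v :
    u \in S -> e u v ->
    (forall f, lipschitz f -> forall x y k,
      x \in S -> y \in S -> f x <= k < f y -> exists2 z, z \in S & f z = k) ->
  forall f, lipschitz f -> forall x y k,
    x \in v |: S -> y \in v |: S -> f x <= k < f y ->
    exists2 z, z \in v |: S & f z = k.
Proof.
move=> Su euv gap_free f f_lip x y k.
have lip1 := f_lip _ _ euv; have lip2 : f u <= (f v).+1 by rewrite f_lip // e_sym.
have inS : forall x y, x \in S -> y \in S -> f x <= k < f y ->
    exists2 z, z \in v |: S & f z = k.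
  move=> a b Sa Sb lt_k; have [z Sz fz] := gap_free _ f_lip _ _ _ Sa Sb lt_k.
  by exists z; rewrite // !inE Sz orbT.
(* Since [f u] and [f v] differ by at most 1, once both differ from [k] they lie on the same side of
   it, and [u] can stand in for [v]. *)
have [fu|ne_u] := eqVneq (f u) k; first by exists u; rewrite // !inE Su orbT.
have [fv|ne_v] := eqVneq (f v) k; first by exists v; rewrite // !inE eqxx.
case/setU1P=> [->|Sx]; case/setU1P=> [->|Sy] lt_k; first by lia.
- by apply: (inS u y) => //; lia.
- by apply: (inS x u) => //; lia.
- exact: (inS x y).
Qed.

Lemma connected_cut_edge (S : {set T}) :
  S != set0 -> S != setT -> exists u v, [/\ u \in S, v \notin S & e u v].
Proof.
move=> /set0Pn[x Sx] /eqP nST.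
case: (pickP (fun uv : T * T => [&& uv.1 \in S, uv.2 \notin S & e uv.1 uv.2])).
  by move=> [u v] /and3P[Su nSv euv]; exists u, v.
(* With no edge leaving [S], every path that starts in [S] stays in [S]. *)
move=> no_edge; case: nST; apply/setP=> y; rewrite inE.
have [p ep ->] := connectP (e_conn x y).
elim: p x Sx ep => //= z p IHp x Sx /andP[exz ep]; apply: (IHp z) => //.
by have := no_edge (x, z); rewrite /= Sx exz andbT /= => /negbFE.
Qed.

(** Distances are taken in the whole graph. The gap-free clause ranges over all 1-Lipschitz [f]
    because each added vertex brings its own distance function. In the last clause [v] is the newest
    vertex. *)
Lemma exists_connected_growth k : k < #|T| ->
  exists S : {set T}, [/\ #|S| = k.+1,
    forall f, lipschitz f -> forall x y j,
      x \in S -> y \in S -> f x <= j < f y -> exists2 z, z \in S & f z = j,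
    \sum_(x in S) \sum_(y in S) dist e x y
      <= (\sum_(j < k.+1) \sum_(i < j.+1) i).*2
  & exists2 v, v \in S &
    \sum_(x in S) \sum_(y in S) dist e x y
      = (\sum_(j < k.+1) \sum_(i < j.+1) i).*2 ->
    exists2 y, y \in S & dist e v y = k].
Proof.
elim: k => [|k IHk] lt_k.
  have [x _] : exists x : T, x \in T by apply/card_gt0P.
  exists [set x]; rewrite cards1 !big_set1 dist_refl; split => //.
    by move=> f _ a b j /set1P-> /set1P->; lia.
  by exists x; rewrite ?inE // => _; exists x; rewrite ?inE ?dist_refl.
have [S [card_S gap_free le_sum _]] := IHk (ltnW lt_k).
have [||u [v [Su nSv euv]]] := @connected_cut_edge S.
- by rewrite -card_gt0 card_S.
- by apply: contraTneq lt_k => ST; rewrite -leqNgt -cardsT -ST card_S.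
have gap_free' := lipschitz_gap_free_insert Su euv gap_free.
have Sv : v \in v |: S by rewrite !inE eqxx.
have card_Sv : #|v |: S| = k.+2 by rewrite cardsU1 nSv card_S.
have lip_v : lipschitz (dist e v) by move=> a b; apply: dist_edge_le.
have [|le_v eq_v] := @sum_gap_free_le _ (dist e v) (v |: S).
  by move=> y j Sy lt_j; apply: (gap_free' _ lip_v v y); rewrite ?dist_refl.
(* The new row and the new column have equal sums, and their common entry is 0. *)
have sumE : \sum_(x in v |: S) \sum_(y in v |: S) dist e x y =
    \sum_(x in S) \sum_(y in S) dist e x y + (\sum_(y in v |: S) dist e v y).*2.
  have sum_row x : x \in S -> \sum_(y in v |: S) dist e x y =
      dist e v x + \sum_(y in S) dist e x y.
    by move=> _; rewrite big_setU1 //= (dist_sym e_conn e_sym).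
  rewrite big_setU1 //= (eq_bigr _ sum_row) big_split /= addnA addnC.
  by rewrite big_setU1 //= dist_refl // add0n addnn.
rewrite card_Sv in le_v eq_v.
have boundE : (\sum_(j < k.+2) \sum_(i < j.+1) i).*2 =
    (\sum_(j < k.+1) \sum_(i < j.+1) i).*2 + (\sum_(i < k.+2) i).*2.
  by rewrite big_ord_recr /= doubleD.
exists (v |: S); rewrite sumE boundE; split=> //; first by rewrite leq_add ?leq_double.
exists v => // eq_sum; apply: eq_v; first by rewrite -card_gt0 card_Sv.
(* The old part is within its own bound, so equality in total forces equality for the row of [v]. *)
apply/eqP; rewrite eqn_leq le_v /= -leq_double.
by rewrite -(leq_add2l (\sum_(j < k.+1) \sum_(i < j.+1) i).*2) -eq_sum leq_add2r.
Qed.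

Lemma wiener_index_le : 0 < #|T| ->
  wiener_index e <= \sum_(j < #|T|) \sum_(i < j.+1) i
  /\ (wiener_index e = \sum_(j < #|T|) \sum_(i < j.+1) i ->
      exists v w, dist e v w = #|T|.-1).
Proof.
move=> T_gt0; have [|S [card_S _ le_sum [v _ eq_sum]]] := @exists_connected_growth #|T|.-1.
  by rewrite prednK.
rewrite prednK // in card_S le_sum eq_sum.
have ST : S = setT by apply/eqP; rewrite eqEcard subsetT cardsT card_S leqnn.
have dbl : \sum_(x in S) \sum_(y in S) dist e x y = (wiener_index e).*2.
  rewrite double_wiener_index // ST; apply: eq_big => x; rewrite ?inE // => _.
  by apply: eq_bigl => y; rewrite inE.
rewrite dbl in le_sum eq_sum; rewrite leq_double in le_sum; split=> // W_eq.
by case: eq_sum; [rewrite W_eq | move=> w _ vw; exists v, w].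
Qed.

End UpperBound.

(** The isomorphism labels each vertex by its distance from [v]. *)
Lemma diameter_path_graph_iso (T : finType) (e : rel T) (v w : T) :
    symmetric e -> irreflexive e -> connected_graph e ->
    dist e v w = #|T|.-1 ->
  graph_iso e (@path_graph #|T|).
Proof.
move=> e_sym e_irr e_conn vw.
have onto k : k < #|T| -> exists x, dist e v x = k.
  move=> lt_k; have: k <= dist e v w by rewrite vw; lia.
  (* Descending from [w]: a vertex at distance [j.+1] has a neighbour at distance [j]. *)
  elim: (_ - k) {-2}k (erefl (dist e v w - k)) => [|m IHm] j; first by exists w; lia.
  move=> def_m le_j; have [||x] := IHm j.+1; try lia.
  by move=> /(dist_pred e_conn)[z _ vz]; exists z.
have sub_d : {subset iota 0 #|T| <= map (dist e v) (enum T)}.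
  by move=> k; rewrite mem_iota => /onto[x <-]; rewrite map_f ?mem_enum.
have size_d : size (map (dist e v) (enum T)) <= size (iota 0 #|T|).
  by rewrite size_map size_iota -cardE.
(* [#|T|] vertices cover [#|T|] values, so no value repeats. *)
have inj_d : injective (dist e v).
  by apply/injectiveP; apply: leq_size_uniq sub_d size_d; apply: iota_uniq.
have lt_d x : dist e v x < #|T|.
  have [_ eq_d] := uniq_min_size (iota_uniq _ _) sub_d size_d.
  by have := eq_d (dist e v x); rewrite map_f ?mem_enum // mem_iota.
exists (fun x => Ordinal (lt_d x)).
  by apply: inj_card_bij; rewrite ?card_ord // => x y [/inj_d].
(* The predecessor of [y] on a shortest path has the label of [x], hence is [x]. *)
have step x y : dist e v y = (dist e v x).+1 -> e x y.
  by move=> /(dist_pred e_conn)[z ezy /inj_d <-].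
move=> x y; rewrite /path_graph /=; apply/idP/idP => [|exy].
  by case/orP=> /eqP/esym/step //; rewrite e_sym.
have := dist_edge_le e_conn v exy; rewrite e_sym in exy.
have := dist_edge_le e_conn v exy.
have: dist e v x != dist e v y.
  by apply: contraTneq exy => /inj_d->; rewrite e_irr.
by lia.
Qed.

(** * The path graph and its Wiener index *)

Lemma path_graph_sym n : symmetric (@path_graph n).
Proof. by move=> i j; rewrite /path_graph orbC. Qed.

Lemma path_graph_connected n : connected_graph (@path_graph n).
Proof.
have up (i j : 'I_n) : i <= j -> connect (@path_graph n) i j.
  elim: (j - i) {-2}j (erefl (j - i)) => [|m IHm] k def_m le_ik.
    by have -> : i = k by apply: val_inj => /=; lia.
  have lt_k : k.-1 < n by have := ltn_ord k; lia.
  apply: (@connect_trans _ _ (Ordinal lt_k)); first by apply: IHm => /=; lia.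
  by apply: connect1; rewrite /path_graph /=; apply/orP; left; apply/eqP; lia.
move=> i j; case: (leqP i j) => [/up //|/ltnW/up].
by rewrite (sym_connect_sym (@path_graph_sym n)).
Qed.

(** Subtraction is truncated, so the left side counts each pair once, with its gap; the right side
    groups the pairs by their larger element. *)
Lemma sum_ord_gap n :
  \sum_(i < n) \sum_(j < n) (j - i) = \sum_(j < n) \sum_(i < j.+1) i.
Proof.
elim: n => [|n IHn]; first by rewrite !big_ord0.
rewrite [RHS]big_ord_recr /= -IHn exchange_big [LHS]big_ord_recr /=; congr (_ + _).
  rewrite [RHS]exchange_big; apply: eq_bigr => i _ /=.
  by rewrite big_ord_recr /= (eqP (ltnW (ltn_ord i))) addn0.
rewrite (reindex_inj rev_ord_inj); apply: eq_bigr => i _ /=.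
by have := ltn_ord i; lia.
Qed.

(** The labelling [h] is 1-Lipschitz, so distances are at least differences of labels. This serves
    both for the path itself and for graphs isomorphic to it. *)
Lemma wiener_index_ge (T : finType) (e : rel T) n :
    symmetric e -> connected_graph e -> graph_iso e (@path_graph n) ->
  \sum_(j < n) \sum_(i < j.+1) i <= wiener_index e.
Proof.
move=> e_sym e_conn [h h_bij h_iso].
rewrite -leq_double double_wiener_index // -addnn -{1}sum_ord_gap -sum_ord_gap.
(* The truncated differences in the two orders add up to the absolute difference of the labels. *)
rewrite [X in _ + X]exchange_big -big_split /= (reindex h) /=; last exact: onW_bij.
apply: leq_sum => x _; rewrite -big_split /= (reindex h) /=; last exact: onW_bij.
apply: leq_sum => y _.
have lip_h a b : e a b -> h b <= (h a).+1.
  by rewrite -h_iso => /orP[] /eqP; lia.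
have := lipschitz_dist e_conn lip_h x y.
have := lipschitz_dist e_conn lip_h y x.
rewrite (dist_sym e_conn e_sym y x); lia.
Qed.

Theorem theorem3p1 (T : finType) (e : rel T) (n s : nat)
    (e_sym : symmetric e) (e_irr : irreflexive e)
    (e_conn : connected_graph e) (card_T : #|T| = n)
    (s_gt0 : 0 < s) (le_2s_n : 2 * s <= n)
    (diam_e : cond_diam e s = n - 2 * s + 1) :
  wiener_index e <= wiener_index (@path_graph n)
  /\ (wiener_index e = wiener_index (@path_graph n)
      <-> graph_iso e (@path_graph n)).
Proof.
have n_gt0 : 0 < n by lia.
have path_sym := @path_graph_sym n.
(* The general upper bound and the lower bound, both applied to the path, pin down its index. *)
have path_W : wiener_index (@path_graph n) = \sum_(j < n) \sum_(i < j.+1) i.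
  apply/eqP; rewrite eqn_leq wiener_index_ge ?andbT //.
  - by have [] := wiener_index_le path_sym (@path_graph_connected n); rewrite card_ord.
  - exact: path_graph_connected.
  - by exists id => //; exists id.
rewrite path_W -card_T in n_gt0 *.
have [le_W eq_W] := wiener_index_le e_sym e_conn n_gt0.
split=> //; split=> [/eq_W[v [w]]|iso_e]; first exact: diameter_path_graph_iso.
by apply/eqP; rewrite eqn_leq le_W wiener_index_ge.
Qed.
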